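(* For real $\alpha$ let $$I_\alpha:=\int_0^\infty\frac{1}{(1+x^2)^{\frac32}}\left(\varphi(x)+\sqrt{\varphi(x)}\right)^{-\alpha}dx,\qquad \varphi(x):=1+\frac43\,\frac{x^2}{(1+x^2)^2}.$$ Then: $$I_0=1,$$ $$I_1=\frac12\;{}_4F_3\left(\begin{array}{c}1\quad \frac12\quad\frac32\quad 1\\ 2\quad \frac34\quad \frac54\end{array};-\frac13\right)=-\frac38\,[\epsilon]\;{}_3F_2\left(\begin{array}{c}\epsilon\quad -\frac12\quad\frac12\\ -\frac14\quad \frac14\end{array};-\frac13\right),$$ $$I_{-1}={}_3F_2\left(\begin{array}{c}1\quad \frac12\quad -\frac12\\ \frac34\quad \frac54\end{array};-\frac13\right)+\frac{53}{45},$$ $$I_{-n}=\sum_{k=0}^n\binom nk\;{}_3F_2\left(\begin{array}{c}-\frac{n+k}{2}\quad 1\quad \frac12\\ \frac34\quad \frac54\end{array};-\frac13\right)\qquad\text{for every } n\in\mathbb{N}=\{1,2,3,\dots\},$$ $$I_2=\frac{3\sqrt2}{8}\arctan\sqrt2+\frac{\sqrt6}{16}\ln\left(5+2\sqrt6\right)-\frac34\;{}_4F_3\left(\begin{array}{c}1\quad 1\quad \frac12\quad \frac52\\ \frac34\quad \frac54\quad 3\end{array};-\frac13\right),$$ $$[\epsilon]\,I_\epsilon=\ln\frac12+2-\frac{\sqrt2}{2}\arctan\sqrt2-\frac{\sqrt6}{4}\ln\left(5+2\sqrt6\right)-\frac{2}{45}\;{}_4F_3\left(\begin{array}{c}1\quad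 1\quad \frac32\quad \frac32\\ 2\quad\frac74\quad \frac94\end{array};-\frac13\right).$$
   Context: The Pochhammer symbol is $(a)_k=a(a+1)\cdots(a+k-1)$, $(a)_0=1$. The generalized hypergeometric function is $${}_pF_q\left(\begin{array}{c}a_1\ \dots\ a_p\\ c_1\ \dots\ c_q\end{array};x\right)=\sum_{k=0}^\infty\frac{(a_1)_k\cdots(a_p)_k}{(c_1)_k\cdots(c_q)_k}\frac{x^k}{k!}$$ (no $c_j$ a nonpositive integer); for $p=q+1$ the series converges for $|x|<1$, in particular at $x=-\frac13$. For a function $h(\epsilon)$ analytic near $\epsilon=0$, $[\epsilon]h(\epsilon)=h'(0)$ denotes its first Taylor coefficient in $\epsilon$ at $0$. *)

(* Defs.v *)
From Stdlib Require Import Reals Factorial Lra Lia List.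
From Coquelicot Require Import Coquelicot.
Import ListNotations.
Open Scope R_scope.

Fixpoint pochhammer (a : R) (k : nat) : R :=
  match k with
  | O => 1
  | S k' => pochhammer a k' * (a + INR k')
  end.

Definition pochhammer_prod (l : list R) (k : nat) : R :=
  fold_right (fun a r => pochhammer a k * r) 1 l.

Definition hyp_term (a c : list R) (x : R) (k : nat) : R :=
  pochhammer_prod a k / pochhammer_prod c k * (x ^ k / INR (fact k)).

(* [pFq a c x] is pFq(a_1 ... a_p; c_1 ... c_q; x) with p = length a and
   q = length c.  [Series] is total; for p = q + 1 and |x| < 1 the series
   converges by [ex_series_hyp_term] below. *)
Definition pFq (a c : list R) (x : R) : R := Series (hyp_term a c x).

Definition phi (x : R) : R := 1 + 4 / 3 * (x ^ 2 / (1 + x ^ 2) ^ 2).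

(* Both bases of [Rpower] are positive, so it is the usual real power. *)
Definition integrand (alpha x : R) : R :=
  1 / Rpower (1 + x ^ 2) (3 / 2) * Rpower (phi x + sqrt (phi x)) (- alpha).

Definition I_alpha (alpha : R) : R :=
  RInt_gen (integrand alpha) (at_point 0) (Rbar_locally p_infty).

(* [eps] h(eps), the first Taylor coefficient at 0; meaningful when
   [ex_derive h 0]. *)
Definition coef1 (h : R -> R) : R := Derive h 0.

Section Convergence.

Let nlin (l : list R) (k : nat) : R :=
  fold_right (fun a r => (a + INR k) / INR (S k) * r) 1 l.

Let lin (l : list R) (k : nat) : R :=
  fold_right (fun a r => (a + INR k) * r) 1 l.

Lemma pochhammer_prod_S (l : list R) (k : nat) :
  pochhammer_prod l (S k) = pochhammer_prod l k * lin l k.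
Proof.
induction l as [|a l IH].
- simpl; ring.
- unfold pochhammer_prod, lin in *; simpl in *; rewrite IH; ring.
Qed.

Lemma lin_nlin (l : list R) (k : nat) :
  lin l k = nlin l k * INR (S k) ^ length l.
Proof.
assert (H : INR (S k) <> 0) by (apply not_0_INR; lia).
induction l as [|a l IH].
- simpl; ring.
- unfold lin, nlin in *; cbn [fold_right length pow].
  rewrite IH; field; exact H.
Qed.

Lemma is_lim_seq_nlin (l : list R) : is_lim_seq (nlin l) 1.
Proof.
induction l as [|a l IH].
- apply is_lim_seq_const.
- replace (Finite 1) with (Finite ((1 + (a - 1) * 0) * 1))
    by (f_equal; ring).
  apply is_lim_seq_mult'; [|exact IH].
  apply (is_lim_seq_ext (fun k => 1 + (a - 1) * / INR (S k))).
  { intros k; rewrite S_INR; pose proof (pos_INR k); field; lra. }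
  apply is_lim_seq_plus'; [apply is_lim_seq_const|].
  apply is_lim_seq_mult'; [apply is_lim_seq_const|].
  apply (is_lim_seq_incr_1 (fun k => / INR k)).
  replace (Finite 0) with (Rbar_inv p_infty) by reflexivity.
  apply is_lim_seq_inv; [apply is_lim_seq_INR|discriminate].
Qed.

Lemma pochhammer_prod_neq0 (c : list R) :
  List.Forall (fun cj => forall m : nat, cj <> - INR m) c ->
  forall k, pochhammer_prod c k <> 0 /\ lin c k <> 0.
Proof.
induction 1 as [|c0 c Hc _ IH]; intros k.
- simpl; lra.
- assert (Hl : forall j, c0 + INR j <> 0).
  { intros j Hj; apply (Hc j); lra. }
  assert (Hp : pochhammer c0 k <> 0).
  { induction k as [|k IHk]; simpl; [lra|].
    apply Rmult_integral_contrapositive; auto. }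
  destruct (IH k); split; apply Rmult_integral_contrapositive; auto.
Qed.

Lemma ex_series_hyp_term (a c : list R) (x : R) :
  length a = S (length c) -> Rabs x < 1 ->
  List.Forall (fun cj => forall m : nat, cj <> - INR m) c ->
  ex_series (hyp_term a c x).
Proof.
intros Hlen Hx Hc.
set (r := fun k => nlin a k / nlin c k * x).
assert (Hr : forall k, hyp_term a c x (S k) = hyp_term a c x k * r k).
{ intros k; unfold hyp_term, r.
  destruct (pochhammer_prod_neq0 c Hc k) as [H1 H2].
  rewrite !pochhammer_prod_S, fact_simpl, mult_INR.
  assert (HS : INR (S k) <> 0) by (apply not_0_INR; lia).
  assert (HF : INR (fact k) <> 0) by apply INR_fact_neq_0.
  assert (Hn : nlin c k <> 0).
  { intros E; apply H2; rewrite lin_nlin, E; ring. }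
  assert (HP : INR (S k) ^ length c <> 0) by (apply pow_nonzero; exact HS).
  rewrite !lin_nlin, Hlen; cbn [pow]; field; auto. }
assert (Hlim : is_lim_seq (fun k => Rabs (r k)) (Rabs x)).
{ replace (Finite (Rabs x)) with (Rbar_abs (1 / 1 * x))
    by (simpl; do 2 f_equal; field).
  apply is_lim_seq_abs; unfold r.
  apply is_lim_seq_mult'; [|apply is_lim_seq_const].
  apply is_lim_seq_div'; [apply is_lim_seq_nlin..|lra]. }
set (q := (Rabs x + 1) / 2).
assert (Hq : 0 <= q < 1) by (unfold q; pose proof (Rabs_pos x); lra).
assert (He : 0 < q - Rabs x) by (unfold q; lra).
apply is_lim_seq_spec in Hlim.
destruct (Hlim (mkposreal _ He)) as [N HN]; simpl in HN.
apply (ex_series_incr_n _ N).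
set (M := Rabs (hyp_term a c x N)).
apply (ex_series_le (V := R_CompleteNormedModule) _ (fun k => M * q ^ k)).
- intros k; change (Rabs (hyp_term a c x (N + k)) <= M * q ^ k).
  induction k as [|k IH].
  + rewrite Nat.add_0_r; simpl; unfold M; lra.
  + rewrite Nat.add_succ_r, Hr, Rabs_mult; simpl.
    replace (M * (q * q ^ k)) with (M * q ^ k * q) by ring.
    apply Rmult_le_compat; try apply Rabs_pos; [exact IH|].
    assert (HNk := HN (N + k)%nat ltac:(lia)).
    apply Rabs_def2 in HNk; lra.
- apply (ex_series_scal_l M (fun k => q ^ k)).
  apply ex_series_geom; rewrite Rabs_pos_eq; lra.
Qed.

End Convergence.

(* Main.v *)
Require Import Defs.
From Stdlib Require Import Reals Factorial List Lra Lia.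
From Coquelicot Require Import Coquelicot.
Import ListNotations.
Open Scope R_scope.

(** The substitution u = x / sqrt (1 + x^2) (that is, x = tan t and u = sin t)
    turns the weight (1 + x^2)^(-3/2) dx into du and phi into 1 + s, where
    s = 4/3 u^2 (1 - u^2) lies in [0, 1/3] for u in [0, 1].  Hence I_alpha is the
    integral over [0, 1] of (r^2 + r)^(-alpha) with r = sqrt (1 + s)
    ([I_alpha_RInt]).

    The moments of s are Beta integrals: s^k has integral
    (1/3)^k (1/2)_k (1)_k / ((3/4)_k (5/4)_k) ([is_RInt_bump_pow]).  So
    integrating a power series in s term by term ([is_RInt_PSeries_bump]), which
    is legitimate when its radius of convergence exceeds 1/3, inserts the
    parameters 1/2, 1 over 3/4, 5/4 and the argument 1/3, which the alternating
    signs of the expansions turn into -1/3.  It remains to expand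
    the integrands in s, always starting from the binomial series
    ([PSeries_binomial]):
    - for alpha = -n, expand (r^2 + r)^n by the binomial theorem into powers of
      1 + s;
    - for alpha = 1, 1 / (r^2 + r) = (1 - 1/r) / s is a shift of the series of
      1/r;
    - for alpha = 2, (1 / (r^2 + r))^2 = 1 / (1 + s) - 2 (1/r - 1 + s/2) / s^2:
      a rational function of u with an elementary integral, and the double shift
      of the series of 1/r;
    - the coefficient of eps in I_eps is minus the integral of
      ln (r^2 + r) = 1/2 ln (1 + s) + ln (1 + r); the first term has an
      elementary integral, and the derivative of ln (1 + r) in s is half of
      1 / (r^2 + r), already expanded.

    Both functions of eps are differentiated at 0 by bounding their
    first-order Taylor remainder by a multiple of eps^2.  In the 3F2 with upper
    parameter eps, the term of index k + 1 is eps (1 + eps)_k times a constant,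
    so its first-order coefficient is k! times that constant; up to a
    common factor, these are the terms of the 4F3 giving I_1. *)

(** * Pochhammer symbols *)

Lemma pochhammer_pos (a : R) (k : nat) : 0 < a -> 0 < pochhammer a k.
Proof.
intros Ha; induction k as [|k IH]; simpl; [lra|].
apply Rmult_lt_0_compat; [exact IH|]; pose proof (pos_INR k); lra.
Qed.

Lemma pochhammer_S_l (a : R) (k : nat) : pochhammer a (S k) = a * pochhammer (a + 1) k.
Proof.
induction k as [|k IH]; [simpl; ring|].
change (pochhammer a (S k) * (a + INR (S k)) = a * (pochhammer (a + 1) k * (a + 1 + INR k))).
rewrite IH, S_INR; ring.
Qed.

Lemma pochhammer_1 (k : nat) : pochhammer 1 k = INR (fact k).
Proof.
induction k as [|k IH]; [reflexivity|].
rewrite fact_simpl, mult_INR, S_INR, <- IH; simpl; ring.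
Qed.

Lemma pochhammer_2 (k : nat) : pochhammer 2 k = INR (fact (S k)).
Proof.
rewrite <- pochhammer_1, pochhammer_S_l, Rmult_1_l; f_equal; ring.
Qed.

Lemma pochhammer_3 (k : nat) : pochhammer 3 k = INR (fact (S (S k))) / 2.
Proof.
rewrite <- pochhammer_1, !pochhammer_S_l.
replace (1 + 1 + 1) with 3 by ring; field.
Qed.

Lemma Rpow_opp_third (k : nat) : (- (1/3)) ^ k = (-1) ^ k * (1/3) ^ k.
Proof. rewrite <- Rpow_mult_distr; f_equal; ring. Qed.

(** * The moments of 4/3 u^2 (1 - u^2) on [0, 1] *)

Definition bump (u : R) : R := 4/3 * (u ^ 2 * (1 - u ^ 2)).

Lemma bump_bounds (u : R) : 0 <= u <= 1 -> 0 <= bump u <= 1/3.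
Proof.
intros Hu; unfold bump.
assert (0 <= u ^ 2 <= 1) by (simpl; nra).
pose proof (Rle_0_sqr (u ^ 2 - 1/2)) as Hsq; unfold Rsqr in Hsq.
split; nra.
Qed.

Lemma bump_pos (u : R) : 0 < u < 1 -> 0 < bump u.
Proof.
intros Hu; unfold bump.
assert (0 < u ^ 2 < 1) by (simpl; nra); nra.
Qed.

Lemma continuous_bump (u : R) : continuous bump u.
Proof. apply (ex_derive_continuous (V := R_NormedModule)); unfold bump; auto_derive; exact I. Qed.

Lemma ex_RInt_cont (f : R -> R) (a b : R) :
  a <= b -> (forall u, a <= u <= b -> continuous f u) -> ex_RInt f a b.
Proof.
intros Hab H; apply (ex_RInt_continuous (V := R_CompleteNormedModule)).
rewrite Rmin_left, Rmax_right by exact Hab; exact H.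
Qed.

(** (4/3)^k times the Beta integral 1/2 B(k + 1/2, k + 1); the parameters 3/4 and
    5/4 come from the duplication formula for Gamma (2 k + 3/2). *)
Definition moment (k : nat) : R :=
  (1/3) ^ k * (pochhammer (1/2) k * pochhammer 1 k /
               (pochhammer (3/4) k * pochhammer (5/4) k)).

(** The recurrence between consecutive Beta integrals is integration by parts.  The
    primitive is u (1 - u^2) s^k times a quadratic
    polynomial in u; the quadratic is the one for which the derivative contains
    only s^(k+1) and s^k, and the primitive vanishes at 0 and 1. *)
Definition moment_primitive (k : nat) (u : R) : R :=
  u * (1 - u ^ 2) * ((4 * INR k + 3) * u ^ 2 - 2 * (INR k + 1)) * bump u ^ k.

Lemma is_derive_moment_primitive (k : nat) (u : R) :
  is_derive (moment_primitive k) u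
    (3/4 * ((4 * INR k + 3) * (4 * INR k + 5)) * bump u ^ S k
     - 2 * (2 * INR k + 1) * (INR k + 1) * bump u ^ k).
Proof.
unfold moment_primitive, bump.
destruct k as [|k].
- auto_derive; [exact I|]. simpl; field.
- auto_derive; [exact I|].
  change (match k with O => 1 | S _ => INR k + 1 end) with (INR (S k)).
  generalize (INR (S k)); intros n; unfold Rminus; simpl; field.
Qed.

Lemma is_RInt_bump_pow (k : nat) : is_RInt (fun u => bump u ^ k) 0 1 (moment k).
Proof.
induction k as [|k IH].
- replace (moment 0) with (scal (1 - 0) 1)
    by (unfold moment, scal; simpl; unfold mult; simpl; field).
  apply (is_RInt_ext (fun _ => 1)); [reflexivity|].
  apply (is_RInt_const (V := R_NormedModule)).
- set (A := 3/4 * ((4 * INR k + 3) * (4 * INR k + 5))).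
  set (B := 2 * (2 * INR k + 1) * (INR k + 1)).
  assert (Hk := pos_INR k).
  assert (HA : A <> 0) by (unfold A; nra).
  assert (HD : is_RInt (fun u => A * bump u ^ S k - B * bump u ^ k) 0 1
                 (minus (moment_primitive k 1) (moment_primitive k 0))).
  { apply (is_RInt_derive (V := R_CompleteNormedModule)).
    - intros u _; apply is_derive_moment_primitive.
    - intros u _; apply (ex_derive_continuous (V := R_NormedModule)).
      unfold bump; auto_derive; exact I. }
  replace (moment (S k)) with
    (scal (/ A) (plus (minus (moment_primitive k 1) (moment_primitive k 0))
       (scal B (moment k)))).
  + apply (is_RInt_ext (fun u =>
      scal (/ A) (plus (A * bump u ^ S k - B * bump u ^ k) (scal B (bump u ^ k))))).
    * intros u _; unfold scal, plus; simpl; unfold mult; simpl.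
      field; exact HA.
    * apply (is_RInt_scal (V := R_NormedModule)).
      apply (is_RInt_plus (V := R_NormedModule)); [exact HD|].
      apply (is_RInt_scal (V := R_NormedModule)); exact IH.
  + unfold moment_primitive, moment, minus, scal, plus, opp; simpl; unfold mult; simpl.
    assert (H3 := pochhammer_pos (3/4) k ltac:(lra)).
    assert (H5 := pochhammer_pos (5/4) k ltac:(lra)).
    unfold A, B; field; repeat split; lra.
Qed.

(** * Termwise integration of power series *)

Lemma is_RInt_sum_f_R0 (g : nat -> R -> R) (l : nat -> R) (a b : R) (n : nat) :
  (forall k, is_RInt (g k) a b (l k)) ->
  is_RInt (fun u => sum_f_R0 (fun k => g k u) n) a b (sum_f_R0 l n).
Proof.
intros H; induction n as [|n IH]; [apply H|].
apply (is_RInt_plus (V := R_NormedModule)); [exact IH|apply H].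
Qed.

(** The remainder of the series at g u is bounded, uniformly in u, by the
    remainder of the absolutely convergent series at rho. *)
Lemma is_series_RInt_PSeries (a : nat -> R) (g : R -> R) (rho : R) :
  Rbar_lt rho (CV_radius a) ->
  (forall u, 0 <= u <= 1 -> continuous g u /\ 0 <= g u <= rho) ->
  is_series (fun k => a k * RInt (fun u => g u ^ k) 0 1)
    (RInt (fun u => PSeries a (g u)) 0 1).
Proof.
intros Hrho Hg.
assert (Hrho0 : 0 <= rho) by (destruct (Hg 0); lra).
assert (Habs : forall x, 0 <= x <= rho -> Rbar_lt (Rabs x) (CV_radius a)).
{ intros x Hx; rewrite Rabs_pos_eq by lra.
  apply (Rbar_le_lt_trans _ rho); [exact (proj2 Hx)|exact Hrho]. }
assert (Hpow : forall k u, 0 <= u <= 1 -> continuous (fun u => g u ^ k) u).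
{ intros k u Hu; apply (continuous_comp g (fun y => y ^ k)); [apply Hg; exact Hu|].
  apply (ex_derive_continuous (V := R_NormedModule)); auto_derive; exact I. }
assert (HI : forall N, is_RInt (fun u => sum_f_R0 (fun k => a k * g u ^ k) N) 0 1
          (sum_f_R0 (fun k => a k * RInt (fun u => g u ^ k) 0 1) N)).
{ intros N; apply (is_RInt_sum_f_R0 (fun k u => a k * g u ^ k)); intros k.
  apply (is_RInt_scal (V := R_NormedModule) (fun u => g u ^ k)).
  apply (RInt_correct (V := R_CompleteNormedModule)), ex_RInt_cont; [lra|apply Hpow]. }
assert (HP : ex_RInt (fun u => PSeries a (g u)) 0 1).
{ apply ex_RInt_cont; [lra|]; intros u Hu; destruct (Hg u Hu) as [Hc Hb].
  apply (continuous_comp g (PSeries a)); [exact Hc|].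
  apply continuity_pt_filterlim, PSeries_continuity, Habs, Hb. }
(* Weierstrass majorant; its remainders bound those of the series at g u. *)
set (b := fun k => Rabs (a k * rho ^ k)).
assert (Hb : ex_series b) by (apply CV_disk_inside, Habs; lra).
set (tail := fun N => Series b - sum_f_R0 b N).
assert (Htail : is_lim_seq tail 0).
{ replace (Finite 0) with (Finite (Series b - Series b)) by (f_equal; ring).
  apply is_lim_seq_minus'; [apply is_lim_seq_const|].
  apply (is_lim_seq_ext (sum_n b)); [intros; apply sum_n_Reals|].
  apply Series_correct, Hb. }
assert (Hrem : forall N u, 0 <= u <= 1 ->
  Rabs (PSeries a (g u) - sum_f_R0 (fun k => a k * g u ^ k) N) <= tail N).
{ intros N u Hu; destruct (Hg u Hu) as [_ Hgu].
  assert (Hex : ex_series (fun k => Rabs (a k * g u ^ k)))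
    by (apply CV_disk_inside, Habs, Hgu).
  unfold PSeries.
  rewrite (Series_incr_n (fun k => a k * g u ^ k) (S N)); [|lia|apply ex_series_Rabs, Hex].
  unfold tail; rewrite (Series_incr_n b (S N)); [|lia|exact Hb].
  simpl pred.
  match goal with |- Rabs (?p + ?q - ?p) <= ?p' + ?q' - ?p' =>
    replace (p + q - p) with q by ring; replace (p' + q' - p') with q' by ring end.
  eapply Rle_trans;
    [apply Series_Rabs, (ex_series_incr_n (fun k => Rabs (a k * g u ^ k)) (S N)), Hex|].
  apply Series_le; [|apply (ex_series_incr_n b (S N)), Hb].
  intros k; split; [apply Rabs_pos|]; unfold b; rewrite !Rabs_mult.
  apply Rmult_le_compat_l; [apply Rabs_pos|].
  rewrite <- !RPow_abs, (Rabs_pos_eq (g u)), (Rabs_pos_eq rho) by lra.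
  apply pow_incr; lra. }
change (is_lim_seq (sum_n (fun k => a k * RInt (fun u => g u ^ k) 0 1))
          (RInt (fun u => PSeries a (g u)) 0 1)).
apply (is_lim_seq_ext (sum_f_R0 (fun k => a k * RInt (fun u => g u ^ k) 0 1)));
  [intros; symmetry; apply sum_n_Reals|].
apply is_lim_seq_spec; intros eps.
apply is_lim_seq_spec in Htail; destruct (Htail eps) as [N HN].
exists N; intros n Hn; specialize (HN n Hn).
assert (HD := is_RInt_minus (V := R_NormedModule) _ _ _ _ _ _
                (RInt_correct (V := R_CompleteNormedModule) _ _ _ HP) (HI n)).
rewrite <- Rabs_Ropp, Ropp_minus_distr.
eapply Rle_lt_trans; [|exact HN].
replace (RInt _ 0 1 - _) with
  (RInt (fun u => minus (PSeries a (g u)) (sum_f_R0 (fun k => a k * g u ^ k) n)) 0 1)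
  by exact (is_RInt_unique _ _ _ _ HD).
eapply Rle_trans; [apply (abs_RInt_le_const _ 0 1 (tail n)); [lra| |]|].
- eexists; exact HD.
- intros u Hu; apply (Hrem n u Hu).
- replace ((1 - 0) * tail n) with (tail n) by ring.
  rewrite Rminus_0_r; apply Rle_abs.
Qed.

Lemma is_RInt_PSeries_bump (a : nat -> R) :
  Rbar_lt (1/3) (CV_radius a) ->
  is_RInt (fun u => PSeries a (bump u)) 0 1 (Series (fun k => a k * moment k)).
Proof.
intros Ha.
replace (Series (fun k => a k * moment k)) with (RInt (fun u => PSeries a (bump u)) 0 1).
- apply (RInt_correct (V := R_CompleteNormedModule)), ex_RInt_cont; [lra|]; intros u Hu.
  apply (continuous_comp bump (PSeries a)); [apply continuous_bump|].
  apply continuity_pt_filterlim, PSeries_continuity.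
  destruct (bump_bounds u Hu) as [H0 H3]; rewrite Rabs_pos_eq by exact H0.
  apply (Rbar_le_lt_trans _ (1/3)); [exact H3|exact Ha].
- symmetry; apply is_series_unique.
  eapply is_series_ext; [|apply (is_series_RInt_PSeries a bump (1/3) Ha)].
  + intros k; cbv beta; f_equal; apply is_RInt_unique, is_RInt_bump_pow.
  + intros u Hu; split; [apply continuous_bump|apply bump_bounds, Hu].
Qed.

(** * The binomial series *)

Definition binomial_coef (b : R) (k : nat) : R :=
  pochhammer (- b) k * (-1) ^ k / INR (fact k).

Lemma binomial_coef_S (b : R) (k : nat) :
  INR (S k) * binomial_coef b (S k) = (b - INR k) * binomial_coef b k.
Proof.
unfold binomial_coef; rewrite fact_simpl, mult_INR; cbn [pochhammer pow].
field; split; [apply INR_fact_neq_0|apply not_0_INR; lia].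
Qed.

Lemma ex_series_binomial (b x : R) :
  Rabs x < 1 -> ex_series (fun k => binomial_coef b k * x ^ k).
Proof.
intros Hx.
apply (ex_series_ext (hyp_term [- b] [] (- x))).
- intros k; unfold hyp_term, binomial_coef; simpl.
  replace (- x) with (-1 * x) by ring; rewrite Rpow_mult_distr.
  field; apply INR_fact_neq_0.
- apply ex_series_hyp_term; [reflexivity|rewrite Rabs_Ropp; exact Hx|constructor].
Qed.

(** A power series converging at a point of modulus y has radius at least y,
    and y can be taken strictly between |x| and 1. *)
Lemma CV_radius_binomial (b x : R) :
  Rabs x < 1 -> Rbar_lt (Rabs x) (CV_radius (binomial_coef b)).
Proof.
intros Hx; set (y := (Rabs x + 1) / 2).
assert (Hp := Rabs_pos x).
assert (Hy : Rabs y = y) by (apply Rabs_pos_eq; unfold y; lra).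
apply (Rbar_lt_le_trans _ y); [unfold y; simpl; lra|].
apply Rbar_not_lt_le; intros Hlt; rewrite <- Hy in Hlt.
apply (CV_disk_outside _ _ Hlt), ex_series_lim_0, ex_series_binomial.
rewrite Hy; unfold y; lra.
Qed.

(** The recurrence of the coefficients is the differential equation
    (1 + x) y' = b y, coefficient by coefficient. *)
Lemma PSeries_binomial_ode (b x : R) :
  Rabs x < 1 ->
  (1 + x) * PSeries (PS_derive (binomial_coef b)) x = b * PSeries (binomial_coef b) x.
Proof.
intros Hx; set (d := PS_derive (binomial_coef b)).
assert (Hd : ex_pseries d x).
{ apply CV_radius_inside; unfold d; rewrite CV_radius_derive.
  apply CV_radius_binomial, Hx. }
rewrite Rmult_plus_distr_r, Rmult_1_l, <- PSeries_incr_1, <- PSeries_scal.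
rewrite <- PSeries_plus; [|exact Hd|apply ex_pseries_incr_1, Hd].
apply PSeries_ext; intros [|k].
- change (d 0%nat + 0 = b * binomial_coef b 0); unfold d, PS_derive.
  rewrite (binomial_coef_S b 0); simpl (INR 0); ring.
- change (d (S k) + d k = b * binomial_coef b (S k)); unfold d, PS_derive.
  rewrite (binomial_coef_S b (S k)); ring.
Qed.

(** The differential equation makes the series times (1 + x)^(-b) constant. *)
Lemma PSeries_binomial (b x : R) :
  Rabs x < 1 -> PSeries (binomial_coef b) x = Rpower (1 + x) b.
Proof.
intros Hx.
set (q := fun t => PSeries (binomial_coef b) t * Rpower (1 + t) (- b)).
assert (Hq : forall t, Rabs t < 1 -> is_derive q t 0).
{ intros t Ht; assert (Ht' := Rabs_def2 _ _ Ht).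
  assert (Hs := is_derive_PSeries _ _ (CV_radius_binomial b t Ht)).
  assert (Hr : is_derive (fun t => Rpower (1 + t) (- b)) t
                 (- b / (1 + t) * Rpower (1 + t) (- b))).
  { unfold Rpower; auto_derive; [lra|]; field; lra. }
  evar_last; [apply (is_derive_mult (PSeries (binomial_coef b)) _ _ _ _ Hs Hr)|].
  { intros; apply Rmult_comm. }
  unfold plus, mult; simpl.
  replace (PSeries (PS_derive (binomial_coef b)) t)
    with (b * PSeries (binomial_coef b) t / (1 + t)).
  - field; lra.
  - rewrite <- PSeries_binomial_ode by exact Ht; field; lra. }
assert (Hc : q x = q 0).
{ destruct (MVT_gen q 0 x (fun _ => 0)) as [c [_ Hc]].
  - intros t Ht; apply Hq, Rabs_def1; revert Ht; apply Rabs_def2 in Hx;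
      unfold Rmin, Rmax; destruct (Rle_dec 0 x); lra.
  - intros t Ht; apply continuity_pt_filterlim.
    apply (ex_derive_continuous (V := R_NormedModule)); exists 0.
    apply Hq, Rabs_def1; revert Ht; apply Rabs_def2 in Hx;
      unfold Rmin, Rmax; destruct (Rle_dec 0 x); lra.
  - lra. }
unfold q in Hc; rewrite PSeries_0, Rplus_0_r in Hc.
replace (Rpower 1 (- b)) with 1 in Hc
  by (unfold Rpower; rewrite ln_1, Rmult_0_r, exp_0; reflexivity).
replace (binomial_coef b 0 * 1) with 1 in Hc by (unfold binomial_coef; simpl; field).
assert (Hinv : Rpower (1 + x) (- b) * Rpower (1 + x) b = 1).
{ rewrite <- Rpower_plus, Rplus_opp_l; apply Rpower_O.
  apply Rabs_def2 in Hx; lra. }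
transitivity (PSeries (binomial_coef b) x * Rpower (1 + x) (- b) * Rpower (1 + x) b).
- rewrite Rmult_assoc, Hinv; ring.
- rewrite Hc; ring.
Qed.

Lemma PSeries_inv_sqrt (s : R) :
  Rabs s < 1 -> PSeries (binomial_coef (- (1/2))) s = / sqrt (1 + s).
Proof.
intros Hs; rewrite PSeries_binomial by exact Hs.
apply Rabs_def2 in Hs.
replace (- (1/2)) with (- (/ 2)) by field.
rewrite Rpower_Ropp, Rpower_sqrt by lra; reflexivity.
Qed.

(** * Power series of 1 / psi, 1 / psi^2 and the logarithm *)

(** phi + sqrt phi as a function of s = phi - 1; below, r stands for
    sqrt (1 + s), so that psi s = r^2 + r. *)
Definition psi (s : R) : R := 1 + s + sqrt (1 + s).

(** Coefficients of (1 - 1/r) / s. *)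
Definition inv_psi_coef : nat -> R := PS_scal (-1) (PS_decr_1 (binomial_coef (- (1/2)))).

Lemma CV_radius_inv_psi (s : R) : Rabs s < 1 -> Rbar_lt (Rabs s) (CV_radius inv_psi_coef).
Proof.
intros Hs; unfold inv_psi_coef; rewrite CV_radius_scal by lra.
rewrite CV_radius_decr_1; apply CV_radius_binomial, Hs.
Qed.

Lemma sqrt_1p (s : R) : 0 < s -> 1 < sqrt (1 + s) /\ sqrt (1 + s) * sqrt (1 + s) = 1 + s.
Proof.
intros Hs; split; [|apply sqrt_sqrt; lra].
rewrite <- sqrt_1 at 1; apply sqrt_lt_1_alt; lra.
Qed.

(** Since s = r^2 - 1, (1 - 1/r) / s = 1 / (r (r + 1)). *)
Lemma PSeries_inv_psi (s : R) : 0 < s < 1 -> PSeries inv_psi_coef s = / psi s.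
Proof.
intros Hs; assert (Ha : Rabs s < 1) by (rewrite Rabs_pos_eq; lra).
assert (H := PSeries_decr_1 _ _ (CV_radius_inside _ _ (CV_radius_binomial (- (1/2)) s Ha))).
rewrite PSeries_inv_sqrt in H by exact Ha.
replace (binomial_coef (- (1/2)) 0) with 1 in H by (unfold binomial_coef; simpl; field).
unfold inv_psi_coef; rewrite PSeries_scal.
destruct (sqrt_1p s) as [Hr Hrr]; [lra|]; unfold psi.
set (P := PSeries _ s) in *; set (r := sqrt (1 + s)) in *.
replace P with ((/ r - 1) / s) by (rewrite H; field; lra).
replace (1 + s) with (r * r) by exact Hrr.
replace s with (r * r - 1) by lra.
field; repeat split; nra.
Qed.

(** The double shift of the series of 1/r sums to (1/r - 1 + s/2) / s^2.
    Expanding (1 - 1/r)^2 = 1 - 2/r + 1/r^2 and adding twice 1/r - 1 + s/2 leaves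
    1 / (1 + s) - 1 + s = s^2 / (1 + s). *)
Lemma PSeries_inv_psi_sqr (s : R) :
  0 < s < 1 -> / (1 + s) - 2 * PSeries (PS_decr_1 (PS_decr_1 (binomial_coef (- (1/2))))) s
    = (/ psi s) ^ 2.
Proof.
intros Hs; assert (Ha : Rabs s < 1) by (rewrite Rabs_pos_eq; lra).
assert (HCV := CV_radius_inv_psi s Ha).
assert (H := PSeries_decr_1 _ _ (CV_radius_inside _ _ HCV)).
rewrite PSeries_inv_psi in H by exact Hs.
replace (inv_psi_coef 0) with (1/2) in H
  by (unfold inv_psi_coef, PS_scal, PS_decr_1, binomial_coef, scal; simpl; unfold mult; simpl; field).
replace (PSeries (PS_decr_1 inv_psi_coef) s)
  with (-1 * PSeries (PS_decr_1 (PS_decr_1 (binomial_coef (- (1/2))))) s) in H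
  by (rewrite <- PSeries_scal; apply PSeries_ext; reflexivity).
destruct (sqrt_1p s) as [Hr Hrr]; [lra|]; unfold psi in *.
set (P := PSeries _ s) in *; set (r := sqrt (1 + s)) in *.
rewrite <- Hrr in *.
replace P with ((1/2 - / (r * r + r)) / s) by (rewrite H; field; lra).
replace s with (r * r - 1) by lra.
field; repeat split; nra.
Qed.

Lemma is_derive_ln_1p_sqrt (t : R) :
  -1 < t -> is_derive (fun t => ln (1 + sqrt (1 + t))) t (1/2 * / psi t).
Proof.
intros Ht; assert (Hr := sqrt_lt_R0 (1 + t) ltac:(lra)).
auto_derive; [repeat split; lra|].
assert (Hrr := sqrt_sqrt (1 + t) ltac:(lra)); unfold psi; rewrite <- Hrr at 3.
field; repeat split; nra.
Qed.

(** Both sides are primitives of half of 1 / psi that agree at s = 0. *)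
Lemma PSeries_ln_1p_sqrt (s : R) :
  0 < s < 1 -> ln (1 + sqrt (1 + s)) = ln 2 + 1/2 * PSeries (PS_Int inv_psi_coef) s.
Proof.
intros Hs; assert (Ha : Rabs s < 1) by (rewrite Rabs_pos_eq; lra).
assert (HI : is_RInt (fun t => 1/2 * / psi t) 0 s
   (minus (ln (1 + sqrt (1 + s))) (ln (1 + sqrt (1 + 0))))).
{ apply (is_RInt_derive (V := R_CompleteNormedModule) (fun t => ln (1 + sqrt (1 + t))));
    rewrite Rmin_left, Rmax_right by lra; intros t Ht.
  - apply is_derive_ln_1p_sqrt; lra.
  - assert (Hr := sqrt_lt_R0 (1 + t) ltac:(lra)).
    apply (ex_derive_continuous (V := R_NormedModule)); unfold psi; auto_derive; split; lra. }
assert (HP : is_RInt (fun t => 1/2 * / psi t) 0 s (1/2 * PSeries (PS_Int inv_psi_coef) s)).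
{ apply (is_RInt_ext (fun t => scal (1/2) (PSeries inv_psi_coef t))).
  - rewrite Rmin_left, Rmax_right by lra; intros t Ht.
    rewrite PSeries_inv_psi by lra; reflexivity.
  - apply (is_RInt_scal (V := R_NormedModule)), is_RInt_PSeries, CV_radius_inv_psi, Ha. }
assert (E := is_RInt_unique _ _ _ _ HI); rewrite (is_RInt_unique _ _ _ _ HP) in E.
rewrite Rplus_0_r, sqrt_1 in E; unfold minus, plus, opp in E; simpl in E.
replace (1 + 1) with 2 in E by ring; rewrite E; ring.
Qed.

(** * Reduction of the improper integral to [0, 1] *)

Lemma bump_gt (u : R) : 0 <= u <= 6/5 -> -1 < bump u.
Proof.
intros Hu; unfold bump; assert (0 <= u ^ 2 <= 36/25) by (simpl; nra); nra.
Qed.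

Lemma psi_pos (s : R) : -1 < s -> 0 < psi s.
Proof. intros Hs; unfold psi; pose proof (sqrt_pos (1 + s)); lra. Qed.

(** The interval extends beyond u = 1, so that the integral up to u is continuous
    in u at 1, as needed for the limit at infinity. *)
Lemma continuous_power (alpha u : R) :
  0 <= u <= 6/5 -> continuous (fun u => Rpower (psi (bump u)) (- alpha)) u.
Proof.
intros Hu; assert (Ha := bump_gt u Hu); assert (Hp := psi_pos _ Ha).
apply (continuous_comp bump (fun s => Rpower (psi s) (- alpha))); [apply continuous_bump|].
apply (ex_derive_continuous (V := R_NormedModule)).
unfold Rpower, psi in *; auto_derive; repeat split; lra.
Qed.

(** The sine of the angle whose tangent is x. *)
Definition sine (x : R) : R := x / sqrt (1 + x ^ 2).

Lemma sine_bounds (x : R) : 0 <= x -> 0 <= sine x <= 1 /\ 1 - sine x ^ 2 = / (1 + x ^ 2).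
Proof.
intros Hx; unfold sine.
assert (H1 : 0 < 1 + x ^ 2) by (simpl; nra).
assert (Hr := sqrt_lt_R0 _ H1).
assert (Hrr := sqrt_sqrt (1 + x ^ 2) ltac:(lra)).
assert (Hle : x <= sqrt (1 + x ^ 2)) by (simpl in *; nra).
set (r := sqrt (1 + x ^ 2)) in *.
repeat split.
- apply Rdiv_le_0_compat; lra.
- apply (Rmult_le_reg_r r); [lra|]; unfold Rdiv; rewrite Rmult_assoc, Rinv_l by lra; lra.
- rewrite <- Hrr; replace (x / r) with (x * / r) by reflexivity.
  rewrite Rpow_mult_distr; replace (x ^ 2) with (r * r - 1) by lra; field; lra.
Qed.

Lemma phi_sine (x : R) : 0 <= x -> phi x + sqrt (phi x) = psi (bump (sine x)).
Proof.
intros Hx; destruct (sine_bounds x Hx) as [_ H].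
assert (H1 : 0 < 1 + x ^ 2) by (simpl; nra).
assert (E : phi x = 1 + bump (sine x)).
{ unfold phi, bump; rewrite H.
  replace (sine x ^ 2) with (1 - / (1 + x ^ 2)) by lra; field; lra. }
rewrite E; reflexivity.
Qed.

Lemma is_derive_sine (x : R) : is_derive sine x (1 / Rpower (1 + x ^ 2) (3/2)).
Proof.
assert (H1 : 0 < 1 + x ^ 2) by (simpl; nra).
assert (Hr := sqrt_lt_R0 _ H1).
assert (Hrr := sqrt_sqrt (1 + x ^ 2) ltac:(lra)).
replace (3/2) with (1 + / 2) by field.
rewrite Rpower_plus, Rpower_1, Rpower_sqrt by lra.
unfold sine; auto_derive; [simpl in *; repeat split; try lra|].
replace (x * (x * 1)) with (x ^ 2) by ring.
set (r := sqrt (1 + x ^ 2)) in *.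
rewrite <- Hrr; replace (x ^ 2) with (r * r - 1) by lra.
field_simplify_eq; [|lra].
replace (x ^ 2) with (r * r - 1) by lra; ring.
Qed.

(** For 0 <= u <= 1, 1 - u <= 1 - u^2, and here 1 - u^2 = 1 / (1 + x^2). *)
Lemma filterlim_sine : filterlim sine (Rbar_locally p_infty) (locally 1).
Proof.
apply filterlim_locally; intros eps.
exists (Rmax 1 (/ eps)); intros x Hx.
assert (H1 := Rmax_l 1 (/ eps)); assert (H2 := Rmax_r 1 (/ eps)).
destruct (sine_bounds x) as [Hb E]; [lra|].
assert (Hinv : / (1 + x ^ 2) < eps).
{ rewrite <- (Rinv_inv eps); apply Rinv_lt_contravar; [|simpl; nra].
  apply Rmult_lt_0_compat; [apply Rinv_0_lt_compat, cond_pos|simpl; nra]. }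
change (Rabs (sine x - 1) < eps).
rewrite Rabs_left1 by lra; simpl in *; nra.
Qed.

Lemma RInt_integrand (alpha b : R) :
  0 <= b ->
  is_RInt (integrand alpha) 0 b
    (RInt (fun u => Rpower (psi (bump u)) (- alpha)) 0 (sine b)).
Proof.
intros Hb; set (f := fun u => Rpower (psi (bump u)) (- alpha)).
replace (RInt f 0 (sine b)) with (RInt f (sine 0) (sine b))
  by (f_equal; unfold sine; field; apply Rgt_not_eq, sqrt_lt_R0; lra).
apply (is_RInt_ext (fun x => scal (1 / Rpower (1 + x ^ 2) (3/2)) (f (sine x)))).
- rewrite Rmin_left, Rmax_right by lra; intros x Hx.
  unfold f, integrand; rewrite phi_sine by lra; reflexivity.
- apply (is_RInt_comp (V := R_CompleteNormedModule) f sine);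
    rewrite Rmin_left, Rmax_right by lra; intros x Hx.
  + apply continuous_power; destruct (sine_bounds x); lra.
  + split; [apply is_derive_sine|].
    apply (ex_derive_continuous (V := R_NormedModule)).
    assert (0 < 1 + x ^ 2) by (simpl; nra).
    unfold Rpower; auto_derive; repeat split; try lra.
    apply Rgt_not_eq, exp_pos.
Qed.

Lemma is_RInt_gen_integrand (alpha : R) :
  is_RInt_gen (integrand alpha) (at_point 0) (Rbar_locally p_infty)
    (RInt (fun u => Rpower (psi (bump u)) (- alpha)) 0 1).
Proof.
set (f := fun u => Rpower (psi (bump u)) (- alpha)).
assert (Hcont : continuous (fun z => RInt f 0 z) 1).
{ apply (continuous_RInt_1 f 0 1).
  exists (mkposreal (1/5) ltac:(lra)); intros z Hz.
  change (Rabs (z - 1) < 1/5) in Hz; apply Rabs_def2 in Hz.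
  apply (RInt_correct (V := R_CompleteNormedModule)), ex_RInt_cont; [lra|].
  intros u Hu; apply continuous_power; lra. }
assert (Hlim : filterlim (fun b => RInt f 0 (sine b)) (Rbar_locally p_infty)
                 (locally (RInt f 0 1)))
  by (eapply filterlim_comp; [apply filterlim_sine|apply Hcont]).
intros P HP.
(* The lower bound is exactly 0; the upper one is eventually positive, where the
   change of variables applies. *)
apply (Filter_prod _ _ _ (fun a => a = 0) (fun b => 0 < b /\ P (RInt f 0 (sine b)))).
- reflexivity.
- apply filter_and; [exists 0; trivial|].
  exact (Hlim P HP).
- intros a b -> [Hb Hp]; exists (RInt f 0 (sine b)); split; [|exact Hp].
  apply RInt_integrand; lra.
Qed.

Lemma I_alpha_RInt (alpha : R) :
  I_alpha alpha = RInt (fun u => Rpower (psi (bump u)) (- alpha)) 0 1.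
Proof.
unfold I_alpha; apply is_RInt_gen_unique, is_RInt_gen_integrand.
Qed.

(** * Values at integer exponents *)

Lemma radius_gt_third (a : nat -> R) :
  (forall s, Rabs s < 1 -> Rbar_lt (Rabs s) (CV_radius a)) -> Rbar_lt (1/3) (CV_radius a).
Proof.
intros H; rewrite <- (Rabs_pos_eq (1/3)) by lra; apply H.
rewrite Rabs_pos_eq; lra.
Qed.

(** An integrand need only be identified where s > 0, so the removable singularity
    at s = 0 of the expansions divided by s never has to be evaluated. *)
Lemma I_alpha_eq (alpha l : R) (f : R -> R) :
  is_RInt f 0 1 l ->
  (forall u, 0 < u < 1 -> 0 < bump u <= 1/3 -> f u = Rpower (psi (bump u)) (- alpha)) ->
  I_alpha alpha = l.
Proof.
intros Hf Heq; rewrite I_alpha_RInt; apply is_RInt_unique.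
apply (is_RInt_ext f); [|exact Hf].
rewrite Rmin_left, Rmax_right by lra; intros u Hu.
apply Heq; [exact Hu|]; split; [apply bump_pos, Hu|apply bump_bounds; lra].
Qed.

Lemma is_RInt_1 : is_RInt (fun _ => 1) 0 1 1.
Proof.
assert (H := is_RInt_bump_pow 0).
replace (moment 0) with 1 in H by (unfold moment; simpl; field); exact H.
Qed.

Lemma I_alpha_0 : I_alpha 0 = 1.
Proof.
apply (I_alpha_eq 0 1 (fun _ => 1)); [exact is_RInt_1|].
intros u _ Hs; rewrite Ropp_0, Rpower_O; [reflexivity|apply psi_pos; lra].
Qed.

Lemma I_alpha_1 : I_alpha 1 = 1/2 * pFq [1; 1/2; 3/2; 1] [2; 3/4; 5/4] (- (1/3)).
Proof.
eapply eq_trans.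
- apply (I_alpha_eq 1 _ (fun u => PSeries inv_psi_coef (bump u))).
  + apply is_RInt_PSeries_bump, radius_gt_third, CV_radius_inv_psi.
  + intros u _ Hs; rewrite PSeries_inv_psi by lra.
    rewrite Rpower_Ropp, Rpower_1; [reflexivity|apply psi_pos; lra].
- unfold pFq; rewrite <- Series_scal_l; apply Series_ext; intros k.
  change (-1 * binomial_coef (- (1/2)) (S k) * moment k =
          1/2 * hyp_term [1; 1/2; 3/2; 1] [2; 3/4; 5/4] (- (1/3)) k).
  unfold binomial_coef, moment, hyp_term, pochhammer_prod; cbn [fold_right].
  rewrite Ropp_involutive, pochhammer_S_l, pochhammer_2, Rpow_opp_third, !pochhammer_1.
  replace (1/2 + 1) with (3/2) by field.
  assert (H3 := pochhammer_pos (3/4) k ltac:(lra)).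
  assert (H5 := pochhammer_pos (5/4) k ltac:(lra)).
  change ((-1) ^ S k) with (-1 * (-1) ^ k).
  field; repeat split; try lra; apply INR_fact_neq_0.
Qed.

(** The list a is left open because the same three upper parameters occur in
    different orders. *)
Lemma is_RInt_binomial (b : R) (a : list R) :
  (forall k, pochhammer_prod a k = pochhammer_prod [- b; 1; 1/2] k) ->
  is_RInt (fun u => Rpower (1 + bump u) b) 0 1 (pFq a [3/4; 5/4] (- (1/3))).
Proof.
intros Ha.
replace (pFq a [3/4; 5/4] (- (1/3))) with (Series (fun k => binomial_coef b k * moment k)).
- apply (is_RInt_ext (fun u => PSeries (binomial_coef b) (bump u))).
  + rewrite Rmin_left, Rmax_right by lra; intros u Hu.
    destruct (bump_bounds u) as [H0 H1]; [lra|].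
    apply PSeries_binomial; rewrite Rabs_pos_eq; lra.
  + apply is_RInt_PSeries_bump, radius_gt_third, CV_radius_binomial.
- apply Series_ext; intros k; unfold hyp_term; rewrite Ha.
  unfold binomial_coef, moment, pochhammer_prod; cbn [fold_right].
  rewrite pochhammer_1, Rpow_opp_third.
  assert (H3 := pochhammer_pos (3/4) k ltac:(lra)).
  assert (H5 := pochhammer_pos (5/4) k ltac:(lra)).
  field; repeat split; try lra; apply INR_fact_neq_0.
Qed.

Lemma I_alpha_opp_1 : I_alpha (- 1) = pFq [1; 1/2; - (1/2)] [3/4; 5/4] (- (1/3)) + 53/45.
Proof.
replace (53/45) with (1 + moment 1) by (unfold moment; simpl; field).
apply (I_alpha_eq (-1) _ (fun u => plus (Rpower (1 + bump u) (1/2)) (plus 1 (bump u ^ 1)))).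
- apply (is_RInt_plus (V := R_NormedModule)).
  + apply is_RInt_binomial; intros k; unfold pochhammer_prod; simpl; ring.
  + apply (is_RInt_plus (V := R_NormedModule)); [exact is_RInt_1|apply is_RInt_bump_pow].
- intros u _ Hs; replace (- -1) with 1 by ring; rewrite Rpower_1 by (apply psi_pos; lra).
  replace (1/2) with (/ 2) by field; rewrite Rpower_sqrt by lra.
  unfold psi, plus; simpl; ring.
Qed.

(** The k-th term of the binomial expansion of (r^2 + r)^n is
    r^(2k) r^(n-k) = (1 + s)^((n+k)/2). *)
Lemma psi_pow (s : R) (n : nat) :
  0 < s ->
  psi s ^ n = sum_f_R0 (fun k => Binomial.C n k * Rpower (1 + s) ((INR n + INR k) / 2)) n.
Proof.
intros Hs; unfold psi; rewrite binomial; apply sum_eq; intros k Hk.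
rewrite Rmult_assoc; f_equal.
rewrite <- Rpower_sqrt by lra.
rewrite <- (Rpower_pow k), <- (Rpower_pow (n - k)), Rpower_mult, <- Rpower_plus;
  [|apply exp_pos|lra].
f_equal; rewrite minus_INR by exact Hk; field.
Qed.

Lemma I_alpha_opp_nat (n : nat) :
  I_alpha (- INR n) =
    sum_f_R0 (fun k => Binomial.C n k *
      pFq [- ((INR n + INR k) / 2); 1; 1/2] [3/4; 5/4] (- (1/3))) n.
Proof.
apply (I_alpha_eq (- INR n) _
  (fun u => sum_f_R0 (fun k => Binomial.C n k * Rpower (1 + bump u) ((INR n + INR k) / 2)) n)).
- apply (is_RInt_sum_f_R0
    (fun k u => Binomial.C n k * Rpower (1 + bump u) ((INR n + INR k) / 2))); intros k.
  apply (is_RInt_scal (V := R_NormedModule)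
    (fun u => Rpower (1 + bump u) ((INR n + INR k) / 2))), is_RInt_binomial; reflexivity.
- intros u _ Hs; rewrite Ropp_involutive, Rpower_pow by (apply psi_pos; lra).
  symmetry; apply psi_pow; lra.
Qed.

(** * Elementary integrals *)

Lemma sqrt_6_bounds : 2 < sqrt 6 /\ sqrt 6 * sqrt 6 = 6.
Proof.
split; [|apply sqrt_sqrt; lra].
rewrite <- (sqrt_square 2) at 1 by lra; apply sqrt_lt_1_alt; lra.
Qed.

Definition atan_part (u : R) : R := sqrt 2 * atan (sqrt 2 * u).
Definition log_part (u : R) : R := sqrt 6 * (ln (sqrt 6 + 2 * u) - ln (sqrt 6 - 2 * u)).

Lemma is_derive_atan_part (u : R) : is_derive atan_part u (2 / (1 + 2 * u ^ 2)).
Proof.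
assert (H2 := sqrt_sqrt 2 ltac:(lra)).
unfold atan_part; auto_derive; [exact I|].
replace (2 / (1 + 2 * u ^ 2)) with (sqrt 2 * sqrt 2 / (1 + sqrt 2 * sqrt 2 * u ^ 2))
  by (rewrite H2; reflexivity).
field; rewrite H2; simpl; nra.
Qed.

Lemma is_derive_log_part (u : R) :
  0 <= u <= 1 -> is_derive log_part u (12 / (3 - 2 * u ^ 2)).
Proof.
intros Hu; destruct sqrt_6_bounds as [H1 H2].
unfold log_part; auto_derive; [lra|].
replace (12 / (3 - 2 * u ^ 2)) with (4 * (sqrt 6 * sqrt 6) / (sqrt 6 * sqrt 6 - 4 * u ^ 2))
  by (rewrite H2; field; simpl; nra).
field; repeat split; simpl in *; nra.
Qed.

Lemma log_part_1 : log_part 1 = sqrt 6 * ln (5 + 2 * sqrt 6).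
Proof.
destruct sqrt_6_bounds as [H1 H2]; unfold log_part; f_equal.
rewrite !Rmult_1_r, <- ln_div by lra; f_equal.
(* (sqrt 6 + 2) / (sqrt 6 - 2) = 5 + 2 sqrt 6, after clearing the denominator. *)
apply (Rmult_eq_reg_r (sqrt 6 - 2)); [|lra].
field_simplify; [simpl; nra|lra].
Qed.

Lemma log_part_0 : log_part 0 = 0.
Proof. unfold log_part; rewrite Rmult_0_r, Rplus_0_r, Rminus_0_r; ring. Qed.

(** This factorization splits 1 / (1 + s) into partial fractions: the two
    terms are the derivatives of [atan_part] and [log_part], up to constants. *)
Lemma bump_factor (u : R) : 1 + bump u = (3 - 2 * u ^ 2) * (1 + 2 * u ^ 2) / 3.
Proof. unfold bump; field. Qed.

Lemma is_RInt_inv_1p_bump :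
  is_RInt (fun u => / (1 + bump u)) 0 1
    (3 * sqrt 2 / 8 * atan (sqrt 2) + sqrt 6 / 16 * ln (5 + 2 * sqrt 6)).
Proof.
replace (_ + _) with
  (minus (3/8 * atan_part 1 + 1/16 * log_part 1) (3/8 * atan_part 0 + 1/16 * log_part 0)).
- apply (is_RInt_derive (V := R_CompleteNormedModule)
    (fun u => 3/8 * atan_part u + 1/16 * log_part u));
    rewrite Rmin_left, Rmax_right by lra; intros u Hu;
    (assert (Hu2 : 0 <= u ^ 2 <= 1) by (simpl; nra)).
  + evar_last.
    * apply (is_derive_plus (V := R_NormedModule));
        apply (is_derive_scal (fun u => _ u));
        [apply is_derive_atan_part|apply is_derive_log_part, Hu].
    * unfold plus, scal; simpl plus; cbv [AbelianMonoid.plus]; simpl.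
      rewrite bump_factor; field; simpl in *; lra.
  + apply (continuous_comp bump (fun s => / (1 + s))); [apply continuous_bump|].
    apply (ex_derive_continuous (V := R_NormedModule)).
    destruct (bump_bounds u Hu); auto_derive; lra.
- unfold minus, plus, opp; simpl.
  rewrite log_part_1, log_part_0; unfold atan_part.
  rewrite Rmult_0_r, atan_0, Rmult_1_r; field.
Qed.

(** Integration by parts against u; by the factorization of 1 + s, the
    remaining rational function is -4 plus the derivatives of [atan_part] and of
    half of [log_part]. *)
Lemma is_RInt_ln_1p_bump :
  is_RInt (fun u => ln (1 + bump u)) 0 1
    (- 4 + sqrt 2 * atan (sqrt 2) + sqrt 6 / 2 * ln (5 + 2 * sqrt 6)).
Proof.
set (F := fun u => u * (ln (1 + bump u) - 4) + (atan_part u + 1/2 * log_part u)).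
replace (_ + _) with (minus (F 1) (F 0)).
- apply (is_RInt_derive (V := R_CompleteNormedModule) F);
    rewrite Rmin_left, Rmax_right by lra; intros u Hu;
    (assert (Hu2 : 0 <= u ^ 2 <= 1) by (simpl; nra));
    destruct (bump_bounds u Hu) as [Ha _].
  + assert (Hln : is_derive (fun u => u * (ln (1 + bump u) - 4)) u
       (ln (1 + bump u) - 4 + 8/3 * (u ^ 2 * (1 - 2 * u ^ 2)) / (1 + bump u))).
    { unfold bump in *; auto_derive; [simpl in *; lra|].
      simpl in *; unfold Rminus in *; field; lra. }
    evar_last.
    * apply (is_derive_plus (V := R_NormedModule)); [exact Hln|].
      apply (is_derive_plus (V := R_NormedModule)); [apply is_derive_atan_part|].
      apply (is_derive_scal (fun u => _ u)), is_derive_log_part, Hu.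
    * unfold plus; simpl plus; cbv [AbelianMonoid.plus]; simpl.
      rewrite bump_factor; field; simpl in *; lra.
  + apply (continuous_comp bump (fun s => ln (1 + s))); [apply continuous_bump|].
    apply (ex_derive_continuous (V := R_NormedModule)).
    auto_derive; lra.
- unfold F, minus, plus, opp; simpl.
  rewrite log_part_1, log_part_0; unfold atan_part.
  replace (1 + bump 1) with 1 by (unfold bump; ring).
  rewrite ln_1, Rmult_0_r, atan_0, Rmult_1_r; field.
Qed.

(** * Value at exponent 2 and the integral of the logarithm *)

Lemma I_alpha_2 :
  I_alpha 2 = 3 * sqrt 2 / 8 * atan (sqrt 2) + sqrt 6 / 16 * ln (5 + 2 * sqrt 6)
    - 3/4 * pFq [1; 1; 1/2; 5/2] [3/4; 5/4; 3] (- (1/3)).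
Proof.
set (c := PS_decr_1 (PS_decr_1 (binomial_coef (- (1/2))))).
replace (3/4 * _) with (2 * Series (fun k => c k * moment k)).
- apply (I_alpha_eq 2 _ (fun u => minus (/ (1 + bump u)) (scal 2 (PSeries c (bump u))))).
  + apply (is_RInt_minus (V := R_NormedModule)); [exact is_RInt_inv_1p_bump|].
    apply (is_RInt_scal (V := R_NormedModule)), is_RInt_PSeries_bump, radius_gt_third.
    intros s Hs; unfold c; rewrite !CV_radius_decr_1; apply CV_radius_binomial, Hs.
  + intros u _ Hs; assert (Hp : 0 < psi (bump u)) by (apply psi_pos; lra).
    rewrite Rpower_Ropp; change 2 with (INR 2) at 2; rewrite Rpower_pow, <- pow_inv by exact Hp.
    rewrite <- PSeries_inv_psi_sqr by lra; reflexivity.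
- unfold pFq; rewrite <- !Series_scal_l; apply Series_ext; intros k.
  change (c k) with (binomial_coef (- (1/2)) (S (S k))).
  unfold binomial_coef, moment, hyp_term, pochhammer_prod; cbn [fold_right].
  rewrite Ropp_involutive, !pochhammer_S_l, pochhammer_3, Rpow_opp_third, !pochhammer_1.
  replace (1/2 + 1 + 1) with (5/2) by field.
  assert (H3 := pochhammer_pos (3/4) k ltac:(lra)).
  assert (H5 := pochhammer_pos (5/4) k ltac:(lra)).
  change ((-1) ^ S (S k)) with (-1 * (-1 * (-1) ^ k)).
  field; repeat split; try lra; apply INR_fact_neq_0.
Qed.

Lemma ln_psi (s : R) :
  0 < s < 1 -> ln (psi s) = 1/2 * ln (1 + s) + (ln 2 + 1/2 * PSeries (PS_Int inv_psi_coef) s).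
Proof.
intros Hs; rewrite <- PSeries_ln_1p_sqrt by exact Hs.
destruct (sqrt_1p s) as [Hr Hrr]; [lra|].
unfold psi; set (r := sqrt (1 + s)) in *; rewrite <- Hrr.
replace (r * r + r) with (r * (1 + r)) by ring.
rewrite !ln_mult by lra; field.
Qed.

Lemma Series_log_moment :
  Series (fun k => PS_Int inv_psi_coef k * moment k) =
    4/45 * pFq [1; 1; 3/2; 3/2] [2; 7/4; 9/4] (- (1/3)).
Proof.
rewrite Series_incr_1_aux by (simpl; ring).
unfold pFq; rewrite <- Series_scal_l; apply Series_ext; intros k.
change (PS_Int inv_psi_coef (S k)) with (-1 * binomial_coef (- (1/2)) (S k) / INR (S k)).
unfold binomial_coef, moment, hyp_term, pochhammer_prod; cbn [fold_right].
rewrite Ropp_involutive, !pochhammer_S_l, pochhammer_2, Rpow_opp_third, !pochhammer_1.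
replace (1 + 1) with 2 by ring; rewrite pochhammer_2, fact_simpl, mult_INR.
replace (1/2 + 1) with (3/2) by field.
replace (3/4 + 1) with (7/4) by field; replace (5/4 + 1) with (9/4) by field.
assert (H7 := pochhammer_pos (7/4) k ltac:(lra)).
assert (H9 := pochhammer_pos (9/4) k ltac:(lra)).
change ((-1) ^ S k) with (-1 * (-1) ^ k); change ((1/3) ^ S k) with (1/3 * (1/3) ^ k).
field; repeat split; try lra; try apply INR_fact_neq_0; apply not_0_INR; lia.
Qed.

Lemma is_RInt_ln_psi :
  is_RInt (fun u => ln (psi (bump u))) 0 1
    (- (ln (1/2) + 2 - sqrt 2 / 2 * atan (sqrt 2) - sqrt 6 / 4 * ln (5 + 2 * sqrt 6)
        - 2/45 * pFq [1; 1; 3/2; 3/2] [2; 7/4; 9/4] (- (1/3)))).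
Proof.
replace (- _) with
  (plus (scal (1/2) (- 4 + sqrt 2 * atan (sqrt 2) + sqrt 6 / 2 * ln (5 + 2 * sqrt 6)))
    (plus (scal (ln 2) 1)
       (scal (1/2) (Series (fun k => PS_Int inv_psi_coef k * moment k))))).
- apply (is_RInt_ext (fun u => plus (scal (1/2) (ln (1 + bump u)))
    (plus (scal (ln 2) 1) (scal (1/2) (PSeries (PS_Int inv_psi_coef) (bump u)))))).
  + rewrite Rmin_left, Rmax_right by lra; intros u Hu.
    assert (H0 := bump_pos u Hu); destruct (bump_bounds u) as [_ H1]; [lra|].
    rewrite ln_psi by lra; unfold plus, scal; simpl; unfold mult; simpl; ring.
  + apply (is_RInt_plus (V := R_NormedModule)); [|apply (is_RInt_plus (V := R_NormedModule))];
      apply (is_RInt_scal (V := R_NormedModule)).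
    * exact is_RInt_ln_1p_bump.
    * exact is_RInt_1.
    * apply is_RInt_PSeries_bump, radius_gt_third.
      intros s Hs; rewrite CV_radius_Int; apply CV_radius_inv_psi, Hs.
- rewrite Series_log_moment; replace (1/2) with (/ 2) by field; rewrite ln_Rinv by lra.
  unfold plus, scal; simpl; unfold mult; simpl; field.
Qed.

(** * Derivative of I_alpha at 0 *)

Lemma is_derive_quadratic_remainder (h : R -> R) (d c delta : R) :
  0 < delta ->
  (forall e, Rabs e < delta -> Rabs (h e - h 0 - e * d) <= c * e ^ 2) ->
  is_derive h 0 d.
Proof.
intros Hdelta H; apply is_derive_Reals; intros eps Heps.
assert (Hc : 0 < Rabs c + 1) by (pose proof (Rabs_pos c); lra).
assert (Hd : 0 < Rmin delta (eps / (Rabs c + 1)))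
  by (apply Rmin_pos; [exact Hdelta|apply Rdiv_lt_0_compat; assumption]).
exists (mkposreal _ Hd); simpl; intros e He0 He.
assert (H1 : Rabs e < delta) by (eapply Rlt_le_trans; [exact He|apply Rmin_l]).
assert (H2 : Rabs e < eps / (Rabs c + 1)) by (eapply Rlt_le_trans; [exact He|apply Rmin_r]).
assert (Hpos := Rabs_pos_lt e He0).
rewrite Rplus_0_l.
replace ((h e - h 0) / e - d) with ((h e - h 0 - e * d) / e) by (field; exact He0).
unfold Rdiv at 1; rewrite Rabs_mult, Rabs_inv.
apply (Rmult_lt_reg_r (Rabs e)); [exact Hpos|].
rewrite Rmult_assoc, Rinv_l, Rmult_1_r by lra.
eapply Rle_lt_trans; [apply H, H1|].
rewrite <- pow2_abs; simpl.
apply (Rle_lt_trans _ ((Rabs c + 1) * Rabs e * Rabs e)).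
- pose proof (Rle_abs c); nra.
- apply Rmult_lt_compat_r; [exact Hpos|].
  apply (Rmult_lt_compat_l (Rabs c + 1)) in H2; [|exact Hc].
  replace ((Rabs c + 1) * (eps / (Rabs c + 1))) with eps in H2 by (field; lra).
  exact H2.
Qed.

(** The upper bound comes from exp (-z) >= 1 - z, i.e. exp z <= 1 / (1 - z),
    whose first-order remainder is z^2 / (1 - z). *)
Lemma exp_quadratic_remainder (z : R) : Rabs z <= 1/2 -> Rabs (exp z - 1 - z) <= 2 * z ^ 2.
Proof.
intros Hz; apply Rabs_le_between in Hz.
assert (H1 := exp_ineq1_le z); assert (H2 := exp_ineq1_le (- z)).
assert (H3 : exp z * exp (- z) = 1) by (rewrite <- exp_plus, Rplus_opp_r; apply exp_0).
assert (Hp := exp_pos z).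
rewrite Rabs_pos_eq by lra; simpl; nra.
Qed.

Lemma ln_psi_bounds (s : R) : 0 <= s <= 1/3 -> 0 <= ln (psi s) <= 2.
Proof.
intros Hs; assert (H0 := sqrt_pos (1 + s)).
assert (Hrr := sqrt_sqrt (1 + s) ltac:(lra)).
assert (Hr : sqrt (1 + s) <= 5/3) by nra.
unfold psi; split.
- rewrite <- ln_1; apply ln_le; lra.
- rewrite <- (ln_exp 2); apply ln_le; [lra|].
  pose proof (exp_ineq1_le 2); lra.
Qed.

(** With L = ln (psi s) in [0, 2] and |e| <= 1/4, the remainder of exp (-e L) is
    at most 2 (e L)^2 <= 8 e^2, uniformly in u. *)
Lemma is_derive_I_alpha (l : R) :
  is_RInt (fun u => ln (psi (bump u))) 0 1 (- l) -> is_derive I_alpha 0 l.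
Proof.
intros Hl.
apply (is_derive_quadratic_remainder _ _ 8 (1/4)); [lra|]; intros e He.
rewrite I_alpha_0, I_alpha_RInt.
set (f := fun u => Rpower (psi (bump u)) (- e)).
assert (Hf : is_RInt f 0 1 (RInt f 0 1)).
{ apply (RInt_correct (V := R_CompleteNormedModule)), ex_RInt_cont; [lra|].
  intros u Hu; apply continuous_power; lra. }
assert (HD : is_RInt (fun u => f u - 1 + e * ln (psi (bump u))) 0 1
               (RInt f 0 1 - 1 + e * (- l))).
{ apply (is_RInt_plus (V := R_NormedModule) (fun u => f u - 1)).
  - apply (is_RInt_minus (V := R_NormedModule)); [exact Hf|exact is_RInt_1].
  - apply (is_RInt_scal (V := R_NormedModule) (fun u => ln (psi (bump u)))), Hl. }
replace (RInt f 0 1 - 1 - e * l) with (RInt (fun u => f u - 1 + e * ln (psi (bump u))) 0 1)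
  by (rewrite (is_RInt_unique (V := R_CompleteNormedModule) _ _ _ _ HD); lra).
replace (8 * e ^ 2) with ((1 - 0) * (8 * e ^ 2)) by ring.
apply abs_RInt_le_const; [lra|eexists; exact HD|]; intros u Hu.
assert (HL := ln_psi_bounds _ (bump_bounds u Hu)).
unfold f, Rpower; set (L := ln (psi (bump u))) in *.
replace (exp (- e * L) - 1 + e * L) with (exp (- e * L) - 1 - (- e * L)) by ring.
eapply Rle_trans; [apply exp_quadratic_remainder|].
- rewrite Rabs_mult, Rabs_Ropp, (Rabs_pos_eq L) by lra; pose proof (Rabs_pos e); nra.
- replace (2 * (- e * L) ^ 2) with (2 * (L * L) * e ^ 2) by ring.
  apply Rmult_le_compat_r; [apply pow2_ge_0|nra].
Qed.

(** * Derivative in the upper parameter of the 3F2 *)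

(** (1 + e)_k is a polynomial in e with nonnegative coefficients: its increment from
    0 to e is at most its increment from 0 to |e|, which by convexity is at most
    |e| times its increment from 0 to 1, and (2)_k = (k+1)!. *)
Lemma pochhammer_near_1 (e : R) (k : nat) :
  Rabs e <= 1 ->
  Rabs (pochhammer (1 + e) k - INR (fact k)) <= Rabs e * (INR (fact (S k)) - INR (fact k)).
Proof.
intros He; induction k as [|k IH].
- simpl; rewrite !Rminus_diag, Rabs_R0; lra.
- rewrite (fact_simpl (S k)), mult_INR, (fact_simpl k), mult_INR in *.
  assert (Hk := pos_INR k); rewrite !S_INR in *; cbn [pochhammer].
  assert (Hf := pos_INR (fact k)).
  set (F := INR (fact k)) in *; set (P := pochhammer (1 + e) k) in *.
  replace (P * (1 + e + INR k) - (INR k + 1) * F) with ((P - F) * (1 + e + INR k) + F * e) by ring.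
  eapply Rle_trans; [apply Rabs_triang|].
  rewrite !Rabs_mult, (Rabs_pos_eq F) by exact Hf.
  assert (Hb : Rabs (1 + e + INR k) <= INR k + 2).
  { apply Rabs_le_between in He; rewrite Rabs_pos_eq; lra. }
  assert (H := Rmult_le_compat _ _ _ _ (Rabs_pos _) (Rabs_pos _) IH Hb).
  lra.
Qed.

(** The constant in the term of index k + 1, namely the term divided by
    eps (1 + eps)_k.  Cancelling the first factor of each Pochhammer symbol gives
    the leading 4 = (-1/2)(1/2) / ((-1/4)(1/4)) and makes every remaining
    parameter positive. *)
Definition shifted_coef (k : nat) : R :=
  4 * (pochhammer (1/2) k * pochhammer (3/2) k / (pochhammer (3/4) k * pochhammer (5/4) k))
  * ((- (1/3)) ^ S k / INR (fact (S k))).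

Lemma hyp_term_eps_S (e : R) (k : nat) :
  hyp_term [e; - (1/2); 1/2] [- (1/4); 1/4] (- (1/3)) (S k) =
    e * (pochhammer (1 + e) k * shifted_coef k).
Proof.
unfold hyp_term, shifted_coef, pochhammer_prod; cbn [fold_right].
rewrite !pochhammer_S_l, (Rplus_comm e 1).
replace (- (1/2) + 1) with (1/2) by field; replace (1/2 + 1) with (3/2) by field.
replace (- (1/4) + 1) with (3/4) by field; replace (1/4 + 1) with (5/4) by field.
assert (H3 := pochhammer_pos (3/4) k ltac:(lra)).
assert (H5 := pochhammer_pos (5/4) k ltac:(lra)).
field; repeat split; try lra; apply INR_fact_neq_0.
Qed.

(** As all parameters are positive, absolute values only change the argument
    -1/3 into 1/3, still inside the disk of convergence; the factor (k+1)!
    cancels the one in the denominator. *)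
Lemma ex_series_shifted_coef :
  ex_series (fun k => INR (fact (S k)) * Rabs (shifted_coef k)).
Proof.
apply (ex_series_ext (fun k => 4/3 * hyp_term [1; 1/2; 3/2] [3/4; 5/4] (1/3) k)).
- intros k.
  change (4/3 * hyp_term [1; 1/2; 3/2] [3/4; 5/4] (1/3) k =
          INR (fact (S k)) * Rabs (shifted_coef k)).
  unfold shifted_coef, hyp_term, pochhammer_prod; cbn [fold_right].
  assert (H3 := pochhammer_pos (3/4) k ltac:(lra)).
  assert (H5 := pochhammer_pos (5/4) k ltac:(lra)).
  assert (H1 := pochhammer_pos (1/2) k ltac:(lra)).
  assert (H2 := pochhammer_pos (3/2) k ltac:(lra)).
  rewrite Rabs_mult, (Rabs_pos_eq (4 * _)).
  2: { apply Rmult_le_pos; [lra|].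
       apply Rlt_le, Rdiv_lt_0_compat; apply Rmult_lt_0_compat; assumption. }
  rewrite Rabs_div, (Rabs_pos_eq (INR _)) by (apply pos_INR || apply INR_fact_neq_0).
  rewrite <- RPow_abs, Rabs_Ropp, (Rabs_pos_eq (1/3)) by lra.
  rewrite pochhammer_1; change ((1/3) ^ S k) with (1/3 * (1/3) ^ k).
  field; repeat split; try lra; apply INR_fact_neq_0.
- apply (ex_series_scal_l (4/3) (hyp_term [1; 1/2; 3/2] [3/4; 5/4] (1/3))), ex_series_hyp_term.
  + reflexivity.
  + rewrite Rabs_pos_eq; lra.
  + repeat constructor; intros m; pose proof (pos_INR m); lra.
Qed.

Lemma ex_series_shifted (p : nat -> R) :
  (forall k, Rabs (p k) <= INR (fact (S k))) -> ex_series (fun k => p k * shifted_coef k).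
Proof.
intros Hp; apply (ex_series_le (V := R_CompleteNormedModule) _
  (fun k => INR (fact (S k)) * Rabs (shifted_coef k))); [|exact ex_series_shifted_coef].
intros k; change (Rabs (p k * shifted_coef k) <= INR (fact (S k)) * Rabs (shifted_coef k)).
rewrite Rabs_mult; apply Rmult_le_compat_r; [apply Rabs_pos|apply Hp].
Qed.

Lemma pFq_eps (e : R) :
  Rabs e <= 1 ->
  pFq [e; - (1/2); 1/2] [- (1/4); 1/4] (- (1/3)) =
    1 + e * Series (fun k => pochhammer (1 + e) k * shifted_coef k).
Proof.
intros He; unfold pFq; rewrite Series_incr_1.
- f_equal.
  + unfold hyp_term; simpl; field.
  + rewrite <- Series_scal_l; apply Series_ext; intros k; apply hyp_term_eps_S.
- apply ex_series_hyp_term; [reflexivity|rewrite Rabs_Ropp, Rabs_pos_eq; lra|].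
  apply List.Forall_cons; [|apply List.Forall_cons; [|apply List.Forall_nil]];
    intros [|m]; rewrite ?S_INR; simpl INR; try pose proof (pos_INR m); lra.
Qed.

(** By [pochhammer_near_1] the first-order remainder is at most e^2 times the sum of
    (k+1)! |shifted_coef k|. *)
Lemma is_derive_pFq_eps :
  is_derive (fun e => pFq [e; - (1/2); 1/2] [- (1/4); 1/4] (- (1/3))) 0
    (Series (fun k => INR (fact k) * shifted_coef k)).
Proof.
set (c := Series (fun k => INR (fact (S k)) * Rabs (shifted_coef k))).
assert (Hfact : forall k, INR (fact k) <= INR (fact (S k)))
  by (intros k; apply le_INR; simpl; lia).
apply (is_derive_quadratic_remainder _ _ c 1); [lra|]; intros e He.
assert (Hrem : forall k, Rabs (pochhammer (1 + e) k - INR (fact k)) <= Rabs e * INR (fact (S k))).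
{ intros k; eapply Rle_trans; [apply pochhammer_near_1; lra|].
  apply Rmult_le_compat_l; [apply Rabs_pos|]; pose proof (pos_INR (fact k)); lra. }
assert (Hex1 : ex_series (fun k => INR (fact k) * shifted_coef k)).
{ apply ex_series_shifted; intros k; rewrite Rabs_pos_eq; [apply Hfact|apply pos_INR]. }
assert (Hex2 : ex_series (fun k => (pochhammer (1 + e) k - INR (fact k)) * shifted_coef k)).
{ apply ex_series_shifted; intros k; eapply Rle_trans; [apply Hrem|].
  pose proof (pos_INR (fact (S k))); nra. }
rewrite !pFq_eps by (rewrite ?Rabs_R0; lra).
rewrite (Series_ext (fun k => pochhammer (1 + e) k * shifted_coef k)
  (fun k => INR (fact k) * shifted_coef k +
            (pochhammer (1 + e) k - INR (fact k)) * shifted_coef k)) by (intros k; ring).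
rewrite Series_plus by assumption.
match goal with |- Rabs (1 + e * (?a + ?b) - (1 + 0 * ?x) - e * ?a) <= _ =>
  replace (1 + e * (a + b) - (1 + 0 * x) - e * a) with (e * b) by ring end.
rewrite Rabs_mult, <- pow2_abs.
replace (c * Rabs e ^ 2) with (Rabs e * (Rabs e * c)) by ring.
apply Rmult_le_compat_l; [apply Rabs_pos|].
assert (Hmaj : forall k, 0 <= Rabs ((pochhammer (1 + e) k - INR (fact k)) * shifted_coef k)
    <= Rabs e * (INR (fact (S k)) * Rabs (shifted_coef k))).
{ intros k; split; [apply Rabs_pos|]; rewrite Rabs_mult, <- Rmult_assoc.
  apply Rmult_le_compat_r; [apply Rabs_pos|apply Hrem]. }
assert (Hexm := ex_series_scal_l (Rabs e) _ ex_series_shifted_coef).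
unfold c; rewrite <- Series_scal_l.
eapply Rle_trans; [apply Series_Rabs|apply Series_le; [exact Hmaj|exact Hexm]].
apply (ex_series_le (V := R_CompleteNormedModule) _ _) with (2 := Hexm).
intros k; change (Rabs (Rabs ((pochhammer (1 + e) k - INR (fact k)) * shifted_coef k))
    <= Rabs e * (INR (fact (S k)) * Rabs (shifted_coef k))).
rewrite Rabs_Rabsolu; apply Hmaj.
Qed.

Lemma pFq_coef_eps :
  1/2 * pFq [1; 1/2; 3/2; 1] [2; 3/4; 5/4] (- (1/3)) =
    - (3/8) * Series (fun k => INR (fact k) * shifted_coef k).
Proof.
unfold pFq; rewrite <- !Series_scal_l; apply Series_ext; intros k.
unfold shifted_coef, hyp_term, pochhammer_prod; cbn [fold_right].
rewrite pochhammer_2, !pochhammer_1.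
assert (H3 := pochhammer_pos (3/4) k ltac:(lra)).
assert (H5 := pochhammer_pos (5/4) k ltac:(lra)).
change ((- (1/3)) ^ S k) with (- (1/3) * (- (1/3)) ^ k).
field; repeat split; try lra; apply INR_fact_neq_0.
Qed.

Theorem proposition6 :
  (forall alpha : R,
     ex_RInt_gen (integrand alpha) (at_point 0) (Rbar_locally p_infty)) /\
  I_alpha 0 = 1 /\
  (ex_derive (fun eps => pFq [eps; - (1/2); 1/2] [- (1/4); 1/4] (- (1/3))) 0 /\
   I_alpha 1 = 1/2 * pFq [1; 1/2; 3/2; 1] [2; 3/4; 5/4] (- (1/3)) /\
   1/2 * pFq [1; 1/2; 3/2; 1] [2; 3/4; 5/4] (- (1/3)) =
     - (3/8) * coef1 (fun eps =>
                 pFq [eps; - (1/2); 1/2] [- (1/4); 1/4] (- (1/3)))) /\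
  I_alpha (- 1) = pFq [1; 1/2; - (1/2)] [3/4; 5/4] (- (1/3)) + 53/45 /\
  (forall n : nat, (1 <= n)%nat ->
     I_alpha (- INR n) =
       sum_f_R0 (fun k =>
         Binomial.C n k *
           pFq [- ((INR n + INR k) / 2); 1; 1/2] [3/4; 5/4] (- (1/3))) n) /\
  I_alpha 2 = 3 * sqrt 2 / 8 * atan (sqrt 2)
        + sqrt 6 / 16 * ln (5 + 2 * sqrt 6)
        - 3/4 * pFq [1; 1; 1/2; 5/2] [3/4; 5/4; 3] (- (1/3)) /\
  (ex_derive I_alpha 0 /\
   coef1 (fun eps => I_alpha eps) =
     ln (1/2) + 2 - sqrt 2 / 2 * atan (sqrt 2)
     - sqrt 6 / 4 * ln (5 + 2 * sqrt 6)
     - 2/45 * pFq [1; 1; 3/2; 3/2] [2; 7/4; 9/4] (- (1/3))).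
Proof.
split; [intros alpha; eexists; apply is_RInt_gen_integrand|].
split; [exact I_alpha_0|].
split.
{ split; [eexists; exact is_derive_pFq_eps|].
  split; [exact I_alpha_1|].
  rewrite pFq_coef_eps; f_equal; symmetry.
  exact (is_derive_unique _ _ _ is_derive_pFq_eps). }
split; [exact I_alpha_opp_1|].
split; [intros n _; apply I_alpha_opp_nat|].
split; [exact I_alpha_2|].
assert (H := is_derive_I_alpha _ is_RInt_ln_psi).
split; [eexists; exact H|exact (is_derive_unique _ _ _ H)].
Qed.
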